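(* Let $\Pi=\{n\ge 1:\gcd(n,6)=1\}$. For every $k\ge 1$ and every vector $(\mathfrak o_1,\dots,\mathfrak o_k)$ of positive integers with $\mathfrak s=\mathfrak o_1+\cdots+\mathfrak o_k$: (1) the set $\Sigma(\mathfrak o_1,\dots,\mathfrak o_k)=\{n\in\Pi: V^{[k]}(n)=(\mathfrak o_1,\dots,\mathfrak o_k)\}$ has a $\Pi$-natural density, and $$\mathbb D_\Pi\big(\Sigma(\mathfrak o_1,\dots,\mathfrak o_k)\big)=2^{-\mathfrak s}=2^{-\mathfrak o_1}2^{-\mathfrak o_2}\cdots 2^{-\mathfrak o_k};$$ (2) if $\mathfrak p_1,\dots,\mathfrak p_k$ are independent random variables, each geometrically distributed with parameter $\tfrac12$ (i.e. $\mathbb P[\mathfrak p_j=m]=(\tfrac12)^{m-1}\cdot\tfrac12$ for $m=1,2,\dots$), so that $\mathbb E[\mathfrak p_j]=2$ and $\mathrm{Var}[\mathfrak p_j]=2$, then $$\mathbb P[\mathfrak p_1=\mathfrak o_1,\dots,\mathfrak p_k=\mathfrak o_k]=\mathbb D_\Pi\big(\Sigma(\mathfrak o_1,\dots,\mathfrak o_k)\big).$$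
   Context: For an odd integer $n$ let $\mathfrak o(n)=\mathrm{ord}_2(3n+1)$ (the exponent of the largest power of $2$ dividing $3n+1$), and let the accelerated $3x+1$ map be $U(n)=(3n+1)/2^{\mathfrak o(n)}$; it maps odd integers to integers prime to $6$. For $n\in\Pi$ and $j\ge1$ set $\mathfrak o_j(n)=\mathfrak o(U^{(j-1)}(n))$, where $U^{(i)}$ is the $i$-th iterate ($U^{(0)}=\mathrm{id}$), and let $V^{[k]}(n)=(\mathfrak o_1(n),\dots,\mathfrak o_k(n))$. For $\Sigma\subset\Pi$, its $\Pi$-natural density is $\mathbb D_\Pi(\Sigma)=\lim_{t\to\infty}\frac{3}{t}\#\{n\in\Sigma:n\le t\}$ when the limit exists. *)

(* Defs.v *)
From HB Require Import structures.
From mathcomp Require Import all_boot all_order all_algebra.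
From mathcomp Require Import finmap.
From mathcomp Require Import all_classical all_reals all_analysis.

Set Implicit Arguments.
Unset Strict Implicit.
Unset Printing Implicit Defensive.

Import Order.TTheory GRing.Theory Num.Theory.
Import numFieldNormedType.Exports.

Local Open Scope classical_set_scope.
Local Open Scope ring_scope.

(* [o2] and [U] are meaningful on odd arguments; only the (positive, odd)
   U-orbits of elements of [Pi6] are ever considered. *)
Definition o2 (n : nat) : nat := logn 2 (3 * n + 1).

Definition U (n : nat) : nat := ((3 * n + 1) %/ 2 ^ o2 n)%N.

Definition Pi6 : set nat := [set n | (0 < n)%N /\ gcdn n 6 = 1%N].

Definition o2_ (j n : nat) : nat := o2 (iter j.-1 U n).

Definition V (k n : nat) : k.-tuple nat := [tuple o2_ i.+1 n | i < k].

Definition Sigma (k : nat) (o : k.-tuple nat) : set nat :=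
  [set n | Pi6 n /\ V k n = o].

(* [fset_set] is the junk value [fset0] on infinite sets; the set counted here
   is always finite. *)
Definition Pi_ratio (R : realType) (S : set nat) (t : R) : R :=
  3 / t * #|` fset_set (S `&` [set n | n%:R <= t]) |%:R.

Definition has_Pi_density (R : realType) (S : set nat) : Prop :=
  cvg (Pi_ratio S t @[t --> (+oo : set_system R)]).

Definition Pi_density (R : realType) (S : set nat) : R :=
  lim (Pi_ratio S t @[t --> (+oo : set_system R)]).

Definition independent_RVs d (T : measurableType d) (R : realType)
    (P : probability T R) (k : nat) (X : 'I_k -> {RV P >-> R}) : Prop :=
  forall (J : {set 'I_k}) (B : 'I_k -> set R),
    (forall i, measurable (B i)) ->
    P (\bigcap_(i in [set` J]) (X i @^-1` B i)) =
    (\prod_(i in J) P (X i @^-1` B i))%E.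

Definition geometric_RV d (T : measurableType d) (R : realType)
    (P : probability T R) (q : R) (X : {RV P >-> R}) : Prop :=
  forall m : nat, (0 < m)%N ->
    P (X @^-1` [set m%:R]) = ((1 - q) ^+ m.-1 * q)%:E.

(* Main.v *)
Require Import Defs.
From HB Require Import structures.
From mathcomp Require Import all_boot all_order all_algebra.
From mathcomp Require Import finmap ring lra zify.
From mathcomp Require Import all_classical all_reals all_analysis.
From mathcomp Require Import measurable_realfun.

Import Order.TTheory GRing.Theory Num.Theory.
Import numFieldNormedType.Exports.

Local Open Scope classical_set_scope.
Local Open Scope ring_scope.

(* A vector (o_1, ..., o_k) of positive integers with sum s is the valuation
   vector of an odd n exactly when n lies in one residue class modulo 2^(s+1):
   by induction on k, the condition reads 3n+1 = 2^(o_1) m with m in the class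
   attached to (o_2, ..., o_k), and 3 is invertible modulo 2^(s+1). Removing
   the multiples of 3, which form one class modulo 3 * 2^(s+1), leaves a set of
   natural density (2/3) 2^-(s+1) up to an error O(1/t). The geometric moments
   are sums over the atoms 1, 2, 3, ... of a variable that lives on them almost
   surely. *)

(** * Valuation vectors and residue classes modulo powers of 2 *)

Lemma eqn_modMl_coprime (c d m n : nat) : coprime d c ->
  (c * m == c * n %[mod d])%N = (m == n %[mod d])%N.
Proof.
move=> cdc; wlog le_nm : m n / (n <= m)%N.
  move=> H; case: (leqP n m) => [/H//|/ltnW/H].
  by rewrite eq_sym => ->; exact: eq_sym.
by rewrite !eqn_mod_dvd ?leq_mul2l ?le_nm ?orbT// -mulnBr Gauss_dvdr.
Qed.

(** The Chinese remainder that is 1 modulo 3 and [b] modulo [d] has the form [3 * c + 1]; the factor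
    3 then cancels modulo [d]. *)
Lemma affine3_residue (d b : nat) : coprime 3 d ->
  exists c, forall n, (3 * n + 1 == b %[mod d])%N = (n == c %[mod d])%N.
Proof.
move=> c3d; exists (chinese 3 d 1 b %/ 3)%N => n.
rewrite -[RHS](@eqn_modMl_coprime 3) 1?coprime_sym// -[RHS](eqn_modDr 1).
set x := chinese 3 d 1 b.
suff -> : (3 * (x %/ 3) + 1 = x)%N by rewrite /x (chinese_modr c3d).
by rewrite {2}(divn_eq x 3) mulnC /x (chinese_modl c3d).
Qed.

Lemma o2_pow2M (n a m : nat) : (3 * n + 1 = 2 ^ a * m)%N -> odd m -> o2 n = a.
Proof.
move=> e om; rewrite /o2 e lognM ?expn_gt0 // ?odd_gt0 // pfactorK//.
by rewrite logn_coprime ?coprime2n// addn0.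
Qed.

Lemma pow2_o2_U (n : nat) : (3 * n + 1 = 2 ^ o2 n * U n)%N.
Proof. by rewrite [RHS]mulnC /U divnK// pfactor_dvdnn. Qed.

Lemma odd_U (n : nat) : odd (U n).
Proof.
have n0 : (0 < 3 * n + 1)%N by rewrite addn1.
have [m com e] := pfactor_coprime (erefl : prime 2) n0.
by rewrite /U /o2 {1}e mulnK ?expn_gt0// -coprime2n.
Qed.

(** The vector [V k n] as a plain sequence, which permits structural induction on the prescribed
    entries. *)
Definition valuation_word (k n : nat) : seq nat :=
  mkseq (fun i => o2 (iter i U n)) k.

Lemma valuation_wordS (k n : nat) :
  valuation_word k.+1 n = o2 n :: valuation_word k (U n).
Proof.
rewrite /valuation_word /mkseq /= -[1%N]/(1 + 0)%N iotaDl -map_comp.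
by congr cons; apply: eq_map => i /=; rewrite -iterS iterSr.
Qed.

Lemma valuation_word_residue (s : seq nat) : all (leq 1) s ->
  exists r, forall n,
    (odd n && (valuation_word (size s) n == s)) =
    (n == r %[mod 2 ^ (sumn s).+1])%N.
Proof.
elim: s => [_|a s IH /= /andP[a0 /IH[r Hr]]].
  (* For the empty vector only oddness remains, the class of 1 modulo 2; this accounts for the extra
     1 in the exponent. *)
  by exists 1%N => n; rewrite andbT !modn2 /=; case: odd.
set M := (2 ^ (sumn s).+1)%N in Hr.
have eM : (2 ^ (a + sumn s).+1 = 2 ^ a * M)%N by rewrite -addnS expnD.
have or : odd r by have := Hr r; rewrite eqxx => /andP[].
(* This congruence says at once that [2 ^ a] divides [3 * n + 1] and that the quotient lies in the
   class of [r] modulo [M]. *)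
have [|c Hc] := @affine3_residue (2 ^ a * M) (2 ^ a * r).
  by rewrite -eM coprimeXr.
exists c => n; rewrite eM -Hc valuation_wordS eqseq_cons.
apply/idP/idP => [/and3P[on /eqP ea w]|/eqP e].
  have /eqP e : (U n == r %[mod M])%N by rewrite -Hr odd_U.
  by rewrite pow2_o2_U ea -!muln_modr e.
have /dvdnP[m] : (2 ^ a %| 3 * n + 1)%N.
  apply/eqP; rewrite -(@modn_dvdm (2 ^ a * M)) ?dvdn_mulr// e.
  by rewrite modn_dvdm ?dvdn_mulr// modnMr.
rewrite [RHS]mulnC => em.
have {}e : m = r %[mod M].
  move: e; rewrite em -!muln_modr => /eqP; rewrite eqn_pmul2l ?expn_gt0//.
  by move/eqP.
have /andP[om /eqP w] : odd m && (valuation_word (size s) m == s).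
  by rewrite Hr e.
have oa := o2_pow2M _ _ _ em om.
have Um : U n = m by rewrite /U oa em mulKn ?expn_gt0.
(* Here [a] is positive, so [3 * n + 1] is even. *)
have -> : odd n.
  have := congr1 odd em.
  by rewrite oddD !oddM oddX (gtn_eqF a0) /=; case: odd.
by rewrite oa Um w !eqxx.
Qed.

Lemma V_valuation_wordP (k : nat) (o : k.-tuple nat) (n : nat) :
  V k n = o <-> valuation_word (size o) n = o.
Proof.
have e : val (V k n) = valuation_word (size o) n.
  rewrite size_tuple /V /valuation_word /mkseq /= -val_enum_ord -map_comp.
  by apply: eq_map => i.
by rewrite -e; split=> [->//|/val_inj].
Qed.

(** Being prime to 6 means being odd and not divisible by 3, and oddness is already contained in the
    residue condition. *)
Lemma Sigma_residue (k : nat) (o : k.-tuple nat) :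
  (forall i : 'I_k, (1 <= tnth o i)%N) ->
  exists r, Sigma o = [set n | ((n == r %[mod 2 ^ (sumn o).+1]) &&
                                ~~ (3 %| n))%N].
Proof.
move=> ho; have [|r Hr] := @valuation_word_residue o.
  by apply/allP => x /tnthP[i ->].
have gcd6 n : (gcdn n 6 == 1)%N = odd n && ~~ (3 %| n)%N.
  rewrite -/(coprime n 6) (coprimeMr n 2 3) coprimen2 coprime_sym.
  by rewrite prime_coprime.
exists r; apply/seteqP; split => n /=.
  move=> [[n0 /eqP]]; rewrite gcd6 => /andP[on n3] /V_valuation_wordP w.
  by rewrite -Hr on w eqxx.
rewrite -Hr => /andP[/andP[on /eqP /V_valuation_wordP w] n3]; split => //; split.
  exact: odd_gt0.
by apply/eqP; rewrite gcd6 on.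
Qed.

(** * Counting in residue classes *)

Lemma count_residue (M r x : nat) : (r < M)%N ->
  count (fun n => n %% M == r)%N (iota 0 x) = ((x + (M - r.+1)) %/ M)%N.
Proof.
move=> rM; elim: x => [|x IH]; first by rewrite divn_small//= ltn_subrL; lia.
(* From [x] to [x + 1] the quotient grows by one exactly when [M] divides [x + M - r], that is, when
   [x] is in the class. *)
rewrite -addn1 iotaD count_cat IH /= addn0 add0n addn1 addSn divnS; last lia.
rewrite addnC; congr (nat_of_bool _ + _)%N.
rewrite -{1}(modn_small rM) -(eqn_modDr (M - r)) subnKC 1?ltnW// modnn.
by congr (_ %% _ == _)%N; lia.
Qed.

Lemma count_residue_bounds (M r x : nat) : (0 < M)%N ->
  let c := count (fun n => n == r %[mod M])%N (iota 0 x) in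
  (M * c <= x + M)%N /\ (x <= M * c + M)%N.
Proof.
move=> M0 /=; rewrite count_residue ?ltn_mod//.
set y := (x + _)%N.
have := ltn_mod r M; have := ltn_mod y M; have := divn_eq y M.
by rewrite M0 /y mulnC; move: (y %/ M)%N (y %% M)%N (r %% M)%N; lia.
Qed.

(** The multiples of 3 in the class form one class modulo [3 * M]. After multiplication by [3 * M],
    each of the two counts has error at most [3 * M]. *)
Lemma count_residue_ndvd3 (M r x : nat) : (0 < M)%N -> coprime 3 M ->
  let c := count (fun n => (n == r %[mod M]) && ~~ (3 %| n))%N (iota 0 x) in
  (3 * M * c <= 2 * x + 6 * M)%N /\ (2 * x <= 3 * M * c + 6 * M)%N.
Proof.
move=> M0 c3M /=.
set c := count _ _.
pose c1 := count (fun n => n == r %[mod M])%N (iota 0 x).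
pose c2 := count (fun n => n == chinese 3 M 0 r %[mod (3 * M)])%N (iota 0 x).
have e : (c + c2 = c1)%N.
  have disj : predI (fun n => (n == r %[mod M]) && ~~ (3 %| n))%N
      (fun n => n == chinese 3 M 0 r %[mod (3 * M)])%N =1 pred0.
    move=> n /=; rewrite chinese_remainder// (chinese_modl c3M) mod0n.
    by rewrite -/(dvdn 3 n); case: (3 %| n)%N; rewrite ?andbF.
  rewrite /c /c2 /c1 -count_predUI (eq_count disj) count_pred0 addn0.
  apply: eq_count => n /=.
  rewrite chinese_remainder// (chinese_modr c3M) (chinese_modl c3M) mod0n.
  by rewrite -/(dvdn 3 n); case: (3 %| n)%N; rewrite ?andbF ?andbT ?orbF.
have [] := @count_residue_bounds M r x M0; rewrite -/c1.
have [|] := @count_residue_bounds (3 * M) (chinese 3 M 0 r) x.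
  by rewrite muln_gt0.
by rewrite -/c2; nia.
Qed.

Lemma card_fset_set_le (R : realType) (p : pred nat) (t : R) : 0 <= t ->
  #|` fset_set ([set n | p n] `&` [set n | n%:R <= t])| =
  count p (iota 0 (Num.truncn t).+1).
Proof.
move=> t0; rewrite -size_filter; set s := seq.filter p _.
have -> : [set n | p n] `&` [set n | n%:R <= t] = [set` [fset n in s]%fset].
  have mems n : (n \in [fset n in s]%fset) = p n && (n%:R <= t).
    by rewrite in_fset /= mem_filter mem_iota add0n ltnS truncn_ge_nat.
  by apply/seteqP; split => n /=; rewrite mems; [case=> -> ->|move/andP].
by rewrite set_fsetK card_fseq undup_id// filter_uniq ?iota_uniq.
Qed.

(** * Density of a residue class without its multiples of 3 *)

Lemma cvg_pinfty_div (R : realType) (l a : R) :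
  (l + a / t @[t --> (+oo : set_system R)]) --> l.
Proof.
rewrite -[X in _ --> X]addr0 -[X in _ --> _ + X](mulr0 a).
apply: cvgD; first exact: cvg_cst.
apply: cvgMl_tmp.
apply/gtr0_cvgV0; first exact: nbhs_pinfty_gt.
exact: cvg_id.
Qed.

Lemma Pi_ratio_cvg (R : realType) (M r : nat) : (0 < M)%N -> coprime 3 M ->
  Pi_ratio [set n | ((n == r %[mod M]) && ~~ (3 %| n))%N] t
    @[t --> (+oo : set_system R)] --> (2 / M%:R : R).
Proof.
move=> M0 c3M.
(* The counting error contributes 6 / t, and counting up to [truncn t + 1] instead of [t] at most 2
   / (M t); 9 is a safe bound for both. *)
apply: (@squeeze_cvgr _ _ _ _ (fun t => 2 / M%:R + (- 9) / t)
    (fun t => 2 / M%:R + 9 / t));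
  [|exact: cvg_pinfty_div|exact: cvg_pinfty_div].
near=> t.
have t0 : 0 < t by near: t; exact: nbhs_pinfty_gt.
rewrite /Pi_ratio card_fset_set_le; last exact: ltW.
have [] := @count_residue_ndvd3 M r (Num.truncn t).+1 M0 c3M.
move: (count _ _) => c + +.
have /andP[+ +] := truncn_itv (ltW t0).
rewrite -[(_ <= 2 * _ + _)%N](ler_nat R) -[(2 * _ <= _)%N](ler_nat R).
rewrite !natrD !natrM -[(Num.truncn t).+1]addn1 natrD.
have : 1 <= M%:R :> R by rewrite ler1n.
move: (M%:R : R) (c%:R : R) ((Num.truncn t)%:R : R) => m y x m1 h1 h2 h3 h4.
have m0 : 0 < m by lra.
have tm : 0 < t * m by rewrite mulr_gt0.
apply/andP; split; rewrite -subr_ge0.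
  have -> : 3 / t * y - (2 / m + - 9 / t) = (3 * m * y - 2 * t + 9 * m) / (t * m).
    by field; rewrite !gt_eqF.
  by apply: divr_ge0; [nra|exact: ltW].
have -> : 2 / m + 9 / t - 3 / t * y = (2 * t + 9 * m - 3 * m * y) / (t * m).
  by field; rewrite !gt_eqF.
by apply: divr_ge0; [nra|exact: ltW].
Unshelve. all: by end_near.
Qed.

(** * Moments of the geometric law *)

Lemma ge0_expectation_comp_atoms d (T : measurableType d) (R : realType)
    (P : probability T R) (X : {RV P >-> R}) (a : nat -> R) (f : R -> R) :
  injective a -> P (\bigcup_m X @^-1` [set a m]) = 1%E ->
  measurable_fun setT f -> (forall m, 0 <= f (a m)) ->
  ('E_P[f \o X] =
  \sum_(0 <= m <oo) (f (a m))%:E * P (X @^-1` [set a m]))%E.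
Proof.
move=> a_inj; set A := fun m => X @^-1` [set a m].
rewrite -/(\bigcup_m A m); set D := \bigcup_m A m => PD1 mf f0.
have mA m : measurable (A m) by exact: measurable_funPTI.
have mD : measurable D by exact: bigcup_measurable.
have PDC0 : P (~` D) = 0%E by rewrite probability_setC// PD1 subee.
have mfX : measurable_fun setT (f \o X) by exact: measurableT_comp.
(* Since [f] is known to be nonnegative only at the atoms, the integrand is replaced by its absolute
   value, equal to it almost everywhere. *)
pose g (w : T) : \bar R := `|f (X w)|%:E.
have mg : measurable_fun setT g.
  by apply/measurable_EFinP; exact: measurableT_comp.
have g0 w : (0 <= g w)%E by rewrite lee_fin.
rewrite unlock (@ae_eq_integral _ _ _ _ _ g)//=; last 2 first.
- exact/measurable_EFinP.
- exists (~` D); split=> //; first exact: measurableC.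
  by move=> w /= h [m _ /= Am]; apply: h => _; rewrite /g Am ger0_norm.
(* What is left after dropping a null set is a disjoint union of fibres, with a constant integrand
   on each. *)
rewrite (ge0_negligible_integral (measurableC mD) _ mg _ PDC0)//.
have tA : trivIset setT A.
  by move=> i j _ _ [w [Ai Aj]]; exact: a_inj (etrans (esym Ai) Aj).
rewrite setDE setCK setTI ge0_integral_bigcup//; last exact: measurable_funTS.
apply: eq_eseriesr => m _.
rewrite -integral_cst//; apply: eq_integral => w; rewrite inE /g => -> /=.
by rewrite ger0_norm.
Qed.

Lemma eseries_lim_partial_sums (R : realType) (u S : nat -> R) (l : R) :
  (forall n, \sum_(0 <= m < n) u m = S n) -> S n @[n --> \oo] --> l ->
  (\sum_(0 <= m <oo) (u m)%:E)%E = l%:E.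
Proof.
move=> e cS; apply/cvg_lim => //.
apply: cvg_EFin; first by apply: nearW => n; rewrite sumEFin.
apply: cvg_trans cS; apply: near_eq_cvg; apply: nearW => n /=.
by rewrite sumEFin -e.
Qed.

(** From 4 on, passing to the successor multiplies the cube by at most (5/4)^3 < 2. *)
Lemma leq_cube_pow2 (n : nat) : (n ^ 3 <= 16 * 2 ^ n)%N.
Proof.
case: n => [|[|[|[|n]]]]//; elim: n => [//|n IH]; rewrite (expnS 2 n.+4).
have := leq_mul (leqnn 2) IH.
by move: (2 ^ n.+4)%N => p; rewrite !expnS expn0; nia.
Qed.

Lemma cvg_sub_quadratic_pow2 (R : realType) (l : R) (q : nat -> R) :
  (forall n, 0 <= q n <= 2 * n.+1%:R ^+ 2) ->
  l - q n / 2 ^+ n @[n --> \oo] --> l.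
Proof.
move=> hq; rewrite -[X in _ --> X]subr0; apply: cvgB; first exact: cvg_cst.
(* The cube bound at [n.+1] reads (n+1)^3 <= 32 * 2^n, and the factor 2 in the bound on [q] gives
   64. *)
have h : 64 * n.+1%:R^-1 @[n --> \oo] --> (0 : R).
  by rewrite -(mulr0 64); apply: cvgMl_tmp; exact: cvg_harmonic.
apply: (squeeze_cvgr _ (cvg_cst 0) h); apply: nearW => n.
have /andP[q0 q2] := hq n; rewrite divr_ge0 ?exprn_ge0//=.
have := leq_cube_pow2 n.+1.
rewrite (expnS 2) mulnA -(ler_nat R) !natrM !natrX => h3.
rewrite ler_pdivrMr ?exprn_gt0// mulrAC ler_pdivlMr ?ltr0n//.
apply: (@le_trans _ _ (2 * n.+1%:R ^+ 2 * n.+1%:R)); first by rewrite ler_wpM2r.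
by rewrite -mulrA -exprSr; lra.
Qed.

Lemma geometric_half_pmf d (T : measurableType d) (R : realType)
    (P : probability T R) (X : {RV P >-> R}) (m : nat) :
  geometric_RV (1 / 2) X ->
  P (X @^-1` [set m.+1%:R]) = (2 ^- m.+1)%:E.
Proof.
move=> geoX; rewrite geoX//=; congr (_%:E).
have -> : 1 - 1 / 2 = 2^-1 :> R by field.
by rewrite div1r exprVn -invfM -exprSr.
Qed.

(** [geometric_RV] prescribes only the masses of the positive integers; as these sum to 1, nothing
    is left elsewhere. *)
Lemma geometric_half_support d (T : measurableType d) (R : realType)
    (P : probability T R) (X : {RV P >-> R}) :
  geometric_RV (1 / 2) X ->
  P (\bigcup_m X @^-1` [set m.+1%:R]) = 1%E.
Proof.
move=> geoX; rewrite measure_semi_bigcup; last 3 first.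
- by move=> m; exact: measurable_funPTI.
- move=> i j _ _ [w [Ai Aj]]; have /eqP := etrans (esym Ai) Aj.
  by rewrite eqr_nat => /eqP[].
- by apply: bigcup_measurable => m _; exact: measurable_funPTI.
rewrite (eq_eseriesr (g := fun m => (2 ^- m.+1)%:E)); last first.
  by move=> m _; exact: geometric_half_pmf.
apply: (@eseries_lim_partial_sums _ _ (fun n => 1 - 1 / 2 ^+ n)) => [n|].
  elim: n => [|n IH]; first by rewrite big_geq// expr0 divr1 subrr.
  rewrite big_nat_recr//= IH exprS; field; exact: expf_neq0.
apply: cvg_sub_quadratic_pow2 => n; have := ler0n R n; rewrite -natr1; nra.
Qed.

Lemma geometric_half_expectation d (T : measurableType d) (R : realType)
    (P : probability T R) (X : {RV P >-> R})
    (f : R -> R) (S : nat -> R) (l : R) :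
  geometric_RV (1 / 2) X ->
  measurable_fun setT f -> (forall m : nat, 0 <= f m.+1%:R) ->
  (forall n, \sum_(0 <= m < n) f m.+1%:R / 2 ^+ m.+1 = S n) ->
  S n @[n --> \oo] --> l ->
  ('E_P[f \o X] = l%:E)%E.
Proof.
move=> geoX mf f0 e cS.
rewrite (@ge0_expectation_comp_atoms _ _ _ _ _ (fun m => m.+1%:R))//; last 2 first.
- by move=> i j /eqP; rewrite eqr_nat => /eqP[].
- exact: geometric_half_support.
rewrite (eq_eseriesr (g := fun m => (f m.+1%:R / 2 ^+ m.+1)%:E)); last first.
  by move=> m _; rewrite geometric_half_pmf// -EFinM.
exact: eseries_lim_partial_sums e cS.
Qed.

Lemma geometric_half_mean d (T : measurableType d) (R : realType)
    (P : probability T R) (X : {RV P >-> R}) :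
  geometric_RV (1 / 2) X -> ('E_P[X] = 2%:E)%E.
Proof.
move=> geoX.
(* Closed form of the sum of m / 2^m over 1 <= m <= n. *)
apply: (@geometric_half_expectation _ _ _ _ _ id (fun n => 2 - (n%:R + 2) / 2 ^+ n)) => //.
  elim=> [|n IH]; first by rewrite big_geq// expr0; field.
  rewrite big_nat_recr//= IH exprS -natr1; field; exact: expf_neq0.
apply: cvg_sub_quadratic_pow2 => n; have := ler0n R n; rewrite -natr1; nra.
Qed.

Lemma geometric_half_variance d (T : measurableType d) (R : realType)
    (P : probability T R) (X : {RV P >-> R}) :
  geometric_RV (1 / 2) X -> ('V_P[X] = 2%:E)%E.
Proof.
move=> geoX; rewrite /variance covariance.unlock geometric_half_mean//=.
(* With mean 2, the variance is the sum of (m - 2)^2 / 2^m, whose partial sums have this closed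
   form. *)
apply: (@geometric_half_expectation _ _ _ _ _ (fun x => (x - 2) * (x - 2))
  (fun n => 2 - (n%:R ^+ 2 + 2) / 2 ^+ n)) => //.
- by apply: measurable_funM; exact: measurable_funB.
- by move=> m; rewrite -expr2 sqr_ge0.
- elim=> [|n IH]; first by rewrite big_geq// expr0; field.
  rewrite big_nat_recr//= IH (exprS 2 n) -natr1; field; exact: expf_neq0.
- apply: cvg_sub_quadratic_pow2 => n; have := ler0n R n; rewrite -natr1; nra.
Qed.

Theorem theorem5p3 (R : realType) (k : nat) (hk : (1 <= k)%N)
    (o : k.-tuple nat) (ho : forall i : 'I_k, (1 <= tnth o i)%N) :
  let s := (\sum_(i < k) tnth o i)%N in
  [/\ has_Pi_density R (Sigma o),
      Pi_density R (Sigma o) = 2 ^- s &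
      2 ^- s = \prod_(i < k) 2 ^- tnth o i :> R]
  /\
  (forall (d : measure_display) (T : measurableType d) (P : probability T R)
      (p : 'I_k -> {RV P >-> R}),
    independent_RVs p ->
    (forall i : 'I_k, geometric_RV (1 / 2) (p i)) ->
    (forall i : 'I_k, 'E_P[p i] = 2%:E /\ 'V_P[p i] = 2%:E)%E /\
    P [set w | forall i : 'I_k, p i w = (tnth o i)%:R] =
      (Pi_density R (Sigma o))%:E).
Proof.
move=> s.
have sE : s = sumn o by rewrite /s sumnE big_tuple.
have prodE : 2 ^- s = \prod_(i < k) 2 ^- tnth o i :> R.
  by rewrite prodfV -expr_sum.
have [r SigmaE] := Sigma_residue k o ho.
have Sigma_cvg : Pi_ratio (Sigma o) t @[t --> (+oo : set_system R)]
    --> (2 ^- s : R).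
  rewrite SigmaE sE; set M := (2 ^ _)%N.
  (* The exponent of [M] exceeds the sum by one, which cancels the 2 in the limit. *)
  have -> : 2 ^- sumn o = 2 / M%:R :> R.
    by rewrite natrX exprS invfM mulrA divff// mul1r.
  by apply: Pi_ratio_cvg; rewrite ?expn_gt0// coprimeXr.
have densE : Pi_density R (Sigma o) = 2 ^- s by exact/cvg_lim.
split; first by split=> //; apply/cvg_ex; exists (2 ^- s).
move=> d T P p indep geo; split=> [i|].
  split; [exact: geometric_half_mean|exact: geometric_half_variance].
rewrite densE prodE.
(* Independence is applied to the full index set, with singletons as the Borel sets. *)
have -> : [set w | forall i, p i w = (tnth o i)%:R] =
    \bigcap_(i in [set` [set: 'I_k]%SET]) (p i @^-1` [set (tnth o i)%:R]).
  apply/seteqP; split=> w h i; first by move=> _; exact: h.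
  by apply: h => /=; rewrite finset.in_setT.
rewrite (indep _ (fun i => [set (tnth o i)%:R]))//.
rewrite -prodEFin; apply: eq_big => [i|i _]; first by rewrite finset.in_setT.
by case: (tnth o i) (ho i) => // m _; exact: geometric_half_pmf.
Qed.
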